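(* Let $G$ be a compact metrisable abelian topological group (written additively), let $(\Omega,\mathcal{F},P)$ be a probability space, and let $X,Y:\Omega\to G$ be independent random variables such that $X\sim X+Y$ and $P(Y\in U)>0$ for each nonempty open set $U\subset G$. Then the distribution of $X$ is the Haar measure on $G$ normalised to have total mass $1$.
   Context: A random variable with values in a topological space $G$ is a map $X:\Omega\to G$ such that $X^{-1}(B)$ is measurable for every Borel set $B\subset G$. Its distribution is the Borel probability measure $\mu_X(B)=P(X\in B)$ on $G$. For $G$-valued random variables $X,Z$, $X\sim Z$ means that they have the same distribution, i.e. $\mu_X=\mu_Z$. *)

(* Defs.v *)
From HB Require Import structures.
From mathcomp Require Import all_boot all_order all_algebra.
From mathcomp Require Import all_classical all_reals all_analysis.

Set Implicit Arguments.
Unset Strict Implicit.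
Unset Printing Implicit Defensive.

Import Order.TTheory GRing.Theory Num.Theory.
Import numFieldNormedType.Exports.

Local Open Scope classical_set_scope.
Local Open Scope ring_scope.

Definition metrizable (R : realType) (T : topologicalType) : Prop :=
  exists d : T -> T -> R,
    [/\ forall x y, d x y = 0 <-> x = y,
        forall x y, d x y = d y x,
        forall x y z, d x z <= d x y + d y z &
        forall (x : T) (A : set T),
          nbhs x A <-> exists2 e : R, 0 < e & [set y | d x y < e] `<=` A].

(* [borel G] is a copy of [G] whose measurable sets are the Borel sets of [G];
   it is pointed at 0 because [measurableType] requires a point. *)
Definition borel (G : topologicalZmodType) : Type := G.

Section borel_instances.
Variable G : topologicalZmodType.

HB.instance Definition _ := Choice.on (borel G).
HB.instance Definition _ := isPointed.Build (borel G) (0 : G).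

Lemma borel_measurable0 : <<s @open G >> set0.
Proof. exact: sigma_algebra0. Qed.

Lemma borel_measurableC (A : set (borel G)) :
  <<s @open G >> A -> <<s @open G >> (~` A).
Proof. by move=> mA; rewrite -setTD; exact: sigma_algebraCD. Qed.

Lemma borel_measurable_bigcup (F : (set (borel G))^nat) :
  (forall i, <<s @open G >> (F i)) -> <<s @open G >> (\bigcup_i F i).
Proof. exact: sigma_algebra_bigcup. Qed.

HB.instance Definition _ := @isMeasurable.Build (sigma_display (@open G))
  (borel G) <<s @open G >>
  borel_measurable0 borel_measurableC borel_measurable_bigcup.

End borel_instances.

Definition independent_RVs (d d1 d2 : measure_display)
    (T : measurableType d) (T1 : measurableType d1) (T2 : measurableType d2)
    (R : realType) (P : probability T R)
    (X : {RV P >-> T1}) (Y : {RV P >-> T2}) : Prop :=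
  forall (A : set T1) (B : set T2), measurable A -> measurable B ->
    P (X @^-1` A `&` Y @^-1` B) = (P (X @^-1` A) * P (Y @^-1` B))%E.

(* Stated for bare functions: [pushforward P X] is [distribution P X] when [X]
   is a random variable, and no measurability proof is needed to write a law. *)
Definition same_distribution (d d' : measure_display)
    (T : measurableType d) (T' : measurableType d')
    (R : realType) (P : probability T R) (X Z : T -> T') : Prop :=
  forall B : set T', measurable B -> pushforward P X B = pushforward P Z B.

Record is_haar_measure (R : realType) (G : topologicalZmodType)
    (mu : {measure set (borel G) -> \bar R}) : Prop := IsHaarMeasure {
  haar_neq0 : mu [set: G] != 0%E ;
  haar_finite_compact : forall K : set G, compact K -> (mu K < +oo)%E ;
  haar_outer_regular : forall B : set (borel G), measurable B ->
    mu B = ereal_inf [set mu U | U in [set U : set G | open U /\ B `<=` U]] ;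
  haar_inner_regular : forall U : set G, open U ->
    mu U = ereal_sup [set mu K | K in [set K : set G | compact K /\ K `<=` U]] ;
  haar_invariant : forall (g : G) (B : set (borel G)), measurable B ->
    mu [set g + (x : G) | x in B] = mu B }.

Definition is_normalized_haar_measure (R : realType) (G : topologicalZmodType)
    (mu : {measure set (borel G) -> \bar R}) : Prop :=
  is_haar_measure mu /\ mu [set: G] = 1%E.

(* Main.v *)
Require Import Defs.
From HB Require Import structures.
From mathcomp Require Import all_boot all_order all_algebra.
From mathcomp Require Import all_classical all_reals all_analysis.
From mathcomp Require Import measurable_realfun lra.

Set Implicit Arguments.
Unset Strict Implicit.
Unset Printing Implicit Defensive.

Import Order.TTheory GRing.Theory Num.Theory.
Import numFieldNormedType.Exports.

Local Open Scope classical_set_scope.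
Local Open Scope ring_scope.

(** Let mu and nu be the laws of X and Y. By independence, the hypothesis that
    X and X + Y have the same law says that mu is a fixed point of convolution
    by nu: mu U is the nu-average over y of mu (U - y).

    The core is a minimum principle. For U open, put f g = mu (U - g). Applying
    the fixed-point equation to the open set U - g shows that f is nu-harmonic:
    f g is the nu-average over y of f (y + g). Moreover f is lower
    semicontinuous, because U is an increasing union of compact sets K and, by
    compactness of K, the inclusion K + g `<=` U survives small changes of g.
    Hence f attains its minimum on the compact group G, at m say. If f took a
    value above f m, then the set of y with f (y + m) > c, for some c > f m,
    would be open and nonempty, hence nu-charged, and the average f m of values
    at least f m would exceed f m. So f is constant
    ([fixed_by_convolution_open]): translates of mu agree with mu on open sets,
    which form a pi-system generating the Borel sets, hence they agree
    everywhere ([eq_open_eq_measure]).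

    Working with open sets and lower semicontinuity, instead of integrating
    continuous functions against mu, gives invariance on a generating class
    without a Riesz-type uniqueness theorem. The remaining clauses of the
    definition of Haar measure hold for every Borel probability measure on a
    compact metrizable space: regularity comes from approximating Borel sets
    between a closed and an open set ([probability_regular]). *)

(** * Compact metrizable spaces *)

(** The distance turns T into a pseudometric space with the same
    neighbourhoods, so the statement reduces to the pseudometric case. The
    point x0 is there only because that case is about pointed spaces. *)
Lemma compact_metrizable_second_countable (R : realType)
    (T : topologicalType) (x0 : T) :
  compact [set: T] -> metrizable R T -> @second_countable T.
Proof.
move=> cT [d [d0 dC dD dN]].
pose b (x : T) (e : R) : set T := [set y | d x y < e].
have bc x e : 0 < e -> b x e x by rewrite /b /= (iffRL (d0 x x) erefl).
have bs x y e : b x e y -> b y e x by rewrite /b /= dC.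
have bt x y z e1 e2 : b x e1 y -> b y e2 z -> b x (e1 + e2) z.
  by move=> xy yz; exact: le_lt_trans (dD x y z) (ltrD xy yz).
have nE : @nbhs T T = nbhs_ (entourage_ b).
  apply/funext => x; apply/seteqP; split => A.
    move=> /(dN x A)[e e0 eA]; exists [set p | b p.1 e p.2].
      by exists e.
    by move=> y /xsectionP; exact: eA.
  move=> [V [e e0 eV] VA]; apply/dN; exists e => // y xey.
  by apply/VA/xsectionP; exact: eV.
(* N forgets all of T but its neighbourhoods, so that the uniform structure
   added in M cannot clash with the topology of T. *)
pose N : pnbhsType := HB.pack (T : Type) (Choice.on T)
  (hasNbhs.Build T (@nbhs T T)) (isPointed.Build T x0).
pose M : pseudoPMetricType R := HB.pack (PointedNbhs.sort N)
  (@Nbhs_isPseudoMetric.Build R N (entourage_ b) nE b bc bs bt erefl).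
have [B cB [oB bB]] := @compact_second_countable R M cT.
exists B => //; split => [A /oB|x A xA]; last exact: bB.
by rewrite !openE.
Qed.

Lemma metrizable_hausdorff (R : realType) (T : topologicalType) :
  metrizable R T -> hausdorff_space T.
Proof.
move=> [d [d0 dC dD dN]] p q pq; apply/d0/eqP; rewrite eq_le.
have dpp x : d x x = 0 by apply/d0.
apply/andP; split; rewrite leNgt; apply/negP => dpq0; last first.
  by have := dD p q p; rewrite dpp (dC q p); lra.
have half0 : 0 < d p q / 2 by rewrite divr_gt0.
have [||z [/= pz qz]] := pq [set z | d p z < d p q / 2]
    [set z | d q z < d p q / 2]; [by apply/dN; exists (d p q / 2)..|].
by have := dD p z q; rewrite (dC z q); lra.
Qed.

(** The n-th closed set collects the points at distance at least 1/(n+1) from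
    the complement of U. *)
Lemma open_bigcup_closed (R : realType) (T : topologicalType) (U : set T) :
  metrizable R T -> open U ->
  exists F : (set T)^nat, [/\ forall n, closed (F n),
    {homo F : n m / (n <= m)%N >-> n `<=` m} & \bigcup_n F n = U].
Proof.
move=> [d [d0 dC dD dN]] oU.
exists (fun n => [set x | forall y, ~ U y -> n.+1%:R^-1 <= d x y]); split.
- move=> n; rewrite -openC openE => x /= /existsNP[y].
  move=> /not_implyP[Uy /negP]; rewrite -ltNge => dxy.
  apply/dN; exists (n.+1%:R^-1 - d x y); first by rewrite subr_gt0.
  move=> z /= dxz /(_ y Uy); apply/negP; rewrite -ltNge.
  by apply: le_lt_trans (dD z x y) _; rewrite (dC z x) addrC -ltrBrDl.
- move=> n m nm x /= Fx y /Fx; apply: le_trans.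
  by rewrite lef_pV2 ?posrE// ler_nat.
- apply/seteqP; split => x.
    move=> [n _ Fx]; apply: contrapT => /Fx; rewrite (iffRL (d0 x x) erefl).
    by apply/negP; rewrite -ltNge invr_gt0.
  move=> Ux; have /dN[e e0 eU] : nbhs x U by exact: open_nbhs_nbhs.
  have [n] := ltr_add_invr e0; rewrite add0r => ne.
  exists n => // y Uy; rewrite leNgt; apply/negP => dxy.
  by apply/Uy/eU/(lt_trans dxy).
Qed.

(** The sublevel sets {f <= f y} generate a filter, whose cluster point m
    minimises f: if f y < f m, then the open set {f y < f} would be a
    neighbourhood of m missing {f <= f y}. *)
Lemma lsc_compact_argmin (R : realType) (T : topologicalType) (x0 : T)
    (f : T -> \bar R) :
  compact [set: T] -> (forall c : \bar R, open [set x | (c < f x)%E]) ->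
  exists m, forall x, (f m <= f x)%E.
Proof.
move=> cT lsc.
pose F : set_system T :=
  filter_from [set: T] (fun y => [set z | (f z <= f y)%E]).
have FF : ProperFilter F.
  apply: filter_from_proper; last by move=> y _; exists y => /=.
  apply: filter_from_filter; first by exists x0.
  move=> y z _ _; have [yz|zy] := leP (f y) (f z).
    by exists y => // t /= ty; split => //; exact: le_trans yz.
  by exists z => // t /= tz; split => //; exact: le_trans (ltW zy).
have [m [_ mF]] := cT F FF filterT.
exists m => y; rewrite leNgt; apply/negP => ym.
have [||z [/= zy]] := mF [set z | (f z <= f y)%E] [set z | (f y < f z)%E].
- by exists y.
- by apply: open_nbhs_nbhs; split; [exact: lsc|exact: ym].
- by rewrite ltNge zy.
Qed.

Lemma lt_mu_bigcup d (T : measurableType d) (R : realType)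
    (mu : {measure set T -> \bar R}) (F : (set T)^nat) (c : \bar R) :
  (forall n, measurable (F n)) -> {homo F : n m / (n <= m)%N >-> n `<=` m} ->
  (c < mu (\bigcup_n F n))%E -> exists n, (c < mu (F n))%E.
Proof.
move=> mF ndF; apply: contraPP => /forallNP cF; apply/negP; rewrite -leNgt.
have ndF' : nondecreasing_seq F by move=> n m nm; exact/subsetPset/ndF.
have cvg := nondecreasing_cvg_mu (mu := mu) mF (bigcupT_measurable F mF) ndF'.
rewrite -(cvg_lim _ cvg)//; apply: lime_le; first exact: cvgP cvg.
by apply: nearW => n /=; rewrite leNgt; exact/negP.
Qed.

(** * Borel probability measures on a compact metrizable group *)

Section borel_probability.
Variables (R : realType) (G : topologicalZmodType).
Local Notation B := (borel G).
Hypotheses (G_compact : compact [set: G]) (G_metrizable : metrizable R G).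

Lemma open_borel_measurable (U : set G) : open U -> measurable (U : set B).
Proof. exact: sub_gen_smallest. Qed.

Lemma closed_borel_measurable (C : set G) : closed C -> measurable (C : set B).
Proof.
by move=> cC; rewrite -(setCK C); apply: measurableC;
   apply: open_borel_measurable; exact: closed_openC.
Qed.

Lemma continuous_addr (g : G) : continuous (fun x : G => x + g).
Proof.
move=> x.
exact: (cvg_comp2 cvg_id (cvg_cst g) (@add_continuous G (x, g))).
Qed.

Definition translation (g : G) (x : B) : B := (x : G) + g.

Lemma measurable_translation g : measurable_fun [set: B] (translation g).
Proof.
apply: (@measurability _ _ B B setT (translation g) (@open G) erefl) =>
  _ [U oU <-].
rewrite setTI; apply: open_borel_measurable.
by apply: open_comp => // x _; exact: continuous_addr.
Qed.

HB.instance Definition _ g :=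
  isMeasurableFun.Build _ _ _ _ (translation g) (measurable_translation g).

(** Open sets form a pi-system generating the Borel sets. *)
Lemma eq_open_eq_measure (mu nu : probability B R) :
  (forall U : set G, open U -> mu U = nu U) ->
  forall A, measurable A -> mu A = nu A.
Proof.
move=> munu A mA.
have traceE : [set X : set B | @open G X /\ X `<=` [set: B]] = @open G.
  by apply/seteqP; split => [X []|X oX].
have mtA : <<s [set: B], [set X : set B | @open G X /\ X `<=` [set: B]] >> A.
  by rewrite traceE.
apply: (@g_sigma_algebra_measure_unique_trace _ R B (@open G) [set: B]
  measurableT _ _ mu nu _ _ _ _ A mtA) => //.
- by move=> X [oX _]; exact: open_borel_measurable.
- by rewrite traceE => X Y; exact: openI.
- by rewrite [LHS]probability_setT [RHS]probability_setT.
- by move=> X [+ _]; exact: munu.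
- by rewrite [ltLHS]probability_setT ltry.
Qed.

(** If mu (U - g) > c, some compact K inside U - g already has measure above c,
    and K + h `<=` U for h near g because K is compact. *)
Lemma lsc_mu_translate (mu : probability B R) (U : set G) (c : \bar R) :
  open U -> open [set g : G | (c < mu (translation g @^-1` U))%E].
Proof.
move=> oU.
have nbhs_open (S : set G) : (forall g, S g -> nbhs g S) -> open S.
  by rewrite openE.
apply: nbhs_open => g /= cg.
have [F [cF ndF FU]] := open_bigcup_closed G_metrizable
  (open_comp (fun x _ => @continuous_addr g x) oU).
have [n cn] : exists n, (c < mu (F n : set B))%E.
  apply: lt_mu_bigcup => //; last by rewrite FU.
  by move=> n; exact: closed_borel_measurable.
have /compact_near_coveringP cover : compact (F n).
  exact: subclosed_compact (cF n) G_compact _.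
have nearU x : F n x -> \forall x' \near x & h \near g, U (x' + h).
  move=> Fx; have Uxg : nbhs (x + g) U.
    apply: open_nbhs_nbhs; split => //.
    by rewrite -[U _]/(((fun x => x + g) @^-1` U) x) -FU; exists n.
  exact: (@add_continuous G (x, g)).
apply: filterS (cover _ _ (fun h x => U (x + h)) _ nearU) => h /= FhU.
apply: (lt_le_trans cn).
apply: le_measure; rewrite ?inE//.
- exact: closed_borel_measurable.
- by rewrite -[X in measurable X]setTI; apply: measurable_translation => //;
     exact: open_borel_measurable.
Qed.

Lemma measurable_lsc (f : B -> \bar R) :
  (forall c : \bar R, open [set x : G | (c < f x)%E]) ->
  measurable_fun [set: B] f.
Proof.
move=> lsc; apply: (@measurability _ _ B (\bar R) setT f _
  (ErealGenOInfty.measurableE R)).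
move=> /= _ [_ [a ->]] <-; rewrite setTI preimage_itvoy.
exact: open_borel_measurable (lsc a%:E).
Qed.

(** The Borel sets of G * G are a priori more than the product sigma-algebra; it
    is second countability that writes this open set as a countable union of
    open rectangles. *)
Lemma measurable_add_preimage (U : set G) : open U ->
  measurable [set p : B * B | U ((p.1 : G) + (p.2 : G))].
Proof.
move=> oU.
have [D cD [oD bD]] :=
  compact_metrizable_second_countable (0 : G) G_compact G_metrizable.
pose E := [set VW : set G * set G |
  [/\ D VW.1, D VW.2 & forall x y, VW.1 x -> VW.2 y -> U (x + y)]].
have cE : countable E.
  by apply: sub_countable (countableX cD cD); apply: subset_card_le => VW [].
rewrite (_ : [set _ | _] = \bigcup_(VW in E)
    ((VW.1 : set B) `*` (VW.2 : set B))); last first.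
  apply/seteqP; split => [[x y] /= Uxy|[x y] [[V W] [_ _ VWU] [/= Vx Wy]]];
    last exact: VWU.
  have : nbhs (x + y : G) U by exact: open_nbhs_nbhs.
  move=> /(@add_continuous G (x, y))[[N M] /= [xN yM] NMU].
  have [V [DV Vx] VN] := bD x N xN; have [W [DW Wy] WM] := bD y M yM.
  exists (V, W) => //; split => // s t Vs Wt.
  by apply: (NMU (s, t)); split; [exact: VN|exact: WM].
rewrite bigcup_set_type; apply: countable_bigcupT_measurable.
  by rewrite (eq_countable (card_setT E)).
by move=> [[V W] /= /set_mem[/= DV DW _]]; apply: measurableX;
  apply: open_borel_measurable; exact: oD.
Qed.

(** Independence identifies the law of (Y, X) with the product of the laws of Y
    and X, and the measure of a set for the latter is an integral over y of the
    measures of its sections. *)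
Lemma independent_sum_law d (Omega : measurableType d)
    (P : probability Omega R) (X Y : {RV P >-> B}) (U : set G) :
  independent_RVs X Y -> open U ->
  (P [set w | U ((X w : G) + (Y w : G))%R] =
   \int[distribution P Y]_y distribution P X (translation y @^-1` U))%E.
Proof.
move=> XY oU.
pose S := [set p : B * B | U ((p.1 : G) + (p.2 : G))].
have mS : measurable S by exact: measurable_add_preimage.
have mYX : measurable_fun [set: Omega] (fun w => (Y w, X w)).
  by apply: measurable_fun_pair; exact: measurable_funPT.
pose YX_mixin := isMeasurableFun.Build _ _ _ _ _ mYX.
pose YX : {mfun Omega >-> (B * B)%type} :=
  HB.pack (fun w => (Y w, X w)) YX_mixin.
transitivity (distribution P YX S).
  rewrite /distribution /pushforward; congr (P _); apply/seteqP.
  by split => w /=; rewrite /S /= addrC.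
rewrite -(@product_measure_unique _ _ _ _ R (distribution P Y)
  (distribution P X) (distribution P YX)) //; last first.
  move=> A C mA mC; rewrite muleC -XY//.
  by rewrite /distribution /pushforward setIC.
apply: eq_integral => y _ /=; congr (P _); apply/seteqP.
by split => w /=; rewrite /xsection /= inE /S /translation /= addrC.
Qed.

(** * Fixed points of convolution by a measure of full support *)

(** The minimum principle: g |-> mu (U - g) is lower semicontinuous, attains its
    minimum at some m, and equals its own nu-average, which exceeds the minimum
    as soon as the function is larger on a nonempty open set. *)
Lemma fixed_by_convolution_open (mu nu : probability B R) :
  (forall U : set G, open U ->
    mu U = (\int[nu]_y mu (translation y @^-1` U))%E) ->
  (forall U : set G, open U -> U !=set0 -> (0 < nu U)%E) ->
  forall (g : G) (U : set G), open U -> mu (translation g @^-1` U) = mu U.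
Proof.
move=> mu_fix nu_open g U oU.
pose f (h : G) : R := fine (mu (translation h @^-1` U)).
have fE h : (f h)%:E = mu (translation h @^-1` U).
  by rewrite fineK// fin_num_measure// -[X in measurable X]setTI;
    apply: measurable_translation => //; exact: open_borel_measurable.
have f_lsc (c : \bar R) : open [set h : G | (c < (f h)%:E)%E].
  rewrite (_ : [set h | _] = [set h | (c < mu (translation h @^-1` U))%E]).
    exact: lsc_mu_translate.
  by apply/seteqP; split => h /=; rewrite fE.
have [m fm] := lsc_compact_argmin (0 : G) G_compact f_lsc.
suff f_cst h : f h = f m.
  rewrite -fE (f_cst g) -(f_cst 0) fE; congr (mu _).
  by apply/seteqP; split => x /=; rewrite /translation addr0.
apply/eqP; rewrite eq_le -(lee_fin (f m)) fm andbT leNgt; apply/negP => mh.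
(* On V, which nu charges, the translate of f exceeds c > f m; off V it is at
   least f m. Splitting the average over V and its complement gives f m > f m. *)
pose c := (f m + f h) / 2.
pose V : set G := [set y | (c%:E < (f (y + m))%:E)%E].
have oV : open V.
  apply: (@open_comp _ _ (fun y : G => y + m) _ _ (f_lsc c%:E)) => y _.
  exact: continuous_addr.
have nuV : (0 < nu V)%E.
  apply: nu_open => //; exists (h - m).
  by rewrite /V /= subrK lte_fin /c; lra.
have mV : measurable (V : set B) by exact: open_borel_measurable.
pose fm' (y : B) : \bar R := (f ((y : G) + m))%:E.
have mf : measurable_fun [set: B] fm'.
  apply: measurable_lsc => e.
  apply: (@open_comp _ _ (fun y : G => y + m) _ _ (f_lsc e)) => y _.
  exact: continuous_addr.
have f_ge0 y : (0 <= fm' y)%E by rewrite /fm' fE.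
have fixm : ((f m)%:E = \int[nu]_(y in V) fm' y + \int[nu]_(y in ~` V) fm' y)%E.
  rewrite -ge0_integral_setU//; last 3 first.
  - exact: measurableC.
  - by rewrite setUv.
  - exact/disj_setPCl.
  rewrite setUv fE mu_fix; last first.
    by apply: open_comp => // x _; exact: continuous_addr.
  apply: eq_integral => y _; rewrite /fm' fE; congr (mu _).
  by apply/seteqP; split => x; rewrite /= /translation /= addrA.
have intV : (c%:E * nu V <= \int[nu]_(y in V) fm' y)%E.
  rewrite -integral_cst//; apply: ge0_le_integral => //.
  - by move=> y _; rewrite lee_fin divr_ge0// addr_ge0// fine_ge0.
  - exact: measurable_funTS.
  - by move=> y /ltW.
have intVC : ((f m)%:E * nu (~` V) <= \int[nu]_(y in ~` V) fm' y)%E.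
  rewrite -integral_cst//; last exact: measurableC.
  apply: ge0_le_integral => //.
  - exact: measurableC.
  - by move=> y _; rewrite lee_fin fine_ge0.
  - exact: measurable_funTS.
  - by move=> y _; exact: fm.
have := leeD intV intVC; rewrite -fixm probability_setC//.
have /fineK <- : nu V \is a fin_num by rewrite fin_num_measure.
have : 0 < fine (nu V).
  by rewrite fine_gt0// nuV ltey_eq fin_num_measure.
rewrite -EFinB -!EFinM -EFinD lee_fin => p0; rewrite /c.
by move: p0 mh; nra.
Qed.

(** * Regularity *)

(** The sets that can be squeezed in this way between a closed and an open set
    form a sigma-algebra, and open sets belong to it, being increasing unions of
    closed sets. The symmetric form, with both a closed and an open set, is what
    makes stability under complement immediate. *)
Lemma probability_regular (mu : probability B R) (A : set B) (e : R) :
  measurable A -> 0 < e ->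
  exists C U : set G, [/\ closed C, open U, C `<=` A, A `<=` U &
    (mu ((U : set B) `\` C) <= e%:E)%E].
Proof.
move=> mA; move: A mA e.
pose S := [set A : set B | forall e, 0 < e ->
  exists C U : set G, [/\ closed C, open U, C `<=` A, A `<=` U &
    (mu ((U : set B) `\` C) <= e%:E)%E]].
suff : <<s @open G >> `<=` S by move=> h A mA e; exact: h.
apply: smallest_sub; first split.
- move=> e e0; exists set0, set0; split => //.
  + exact: closed0.
  + exact: open0.
  + by rewrite set0D measure0 lee_fin ltW.
- move=> A SA e e0; have [C [U [cC oU CA AU muUC]]] := SA e e0.
  exists (~` U), (~` C); split.
  + exact: open_closedC.
  + exact: closed_openC.
  + by rewrite setTD; exact: subsetC.
  + by rewrite setTD; exact: subsetC.
  + by rewrite setDE setCK setIC -setDE.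
- move=> A SA e e0.
  have e2 : 0 < e / 2 by rewrite divr_gt0.
  have /choice[C /choice[U CU]] n : exists C U : set G,
      [/\ closed C, open U, C `<=` A n, A n `<=` U &
      (mu ((U : set B) `\` C) <= (e / 2 / (2 ^ n.+1)%:R)%:E)%E].
    by apply: SA; rewrite divr_gt0// ltr0n expn_gt0.
  (* The union of all C n need not be closed: keep finitely many of them, losing
     at most e / 2, while the gaps U n minus C n add up to at most e / 2. *)
  pose D N : set G := \big[setU/set0]_(n < N) C n.
  have DE N : D N = \bigcup_(n < N) C n by rewrite bigcup_mkord.
  have cD N : closed (D N) by apply: closed_bigsetU => n _; have [] := CU n.
  have mD N : measurable (D N : set B) by exact: closed_borel_measurable.
  have mC n : measurable (C n : set B).
    by apply: closed_borel_measurable; have [] := CU n.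
  have mU n : measurable (U n : set B).
    by apply: open_borel_measurable; have [] := CU n.
  pose V : set B := \bigcup_n C n.
  have mV : measurable V by exact: bigcupT_measurable.
  have bigDE : \bigcup_N (D N : set B) = V.
    apply/seteqP; split => x [n _].
      by rewrite DE => -[k _ Ckx]; exists k.
    by move=> Cnx; exists n.+1 => //; rewrite DE; exists n => //=.
  have [N muN] : exists N, (mu V - (e / 2)%:E < mu (D N : set B))%E.
    apply: lt_mu_bigcup => //.
      by move=> n m nm x; rewrite !DE => -[k /= kn Ckx]; exists k => //=;
        exact: leq_trans kn nm.
    by rewrite bigDE lteBlDr// ?fin_num_measure// lteDl ?fin_num_measure.
  exists (D N), (\bigcup_n U n); split => //.
  + by apply: bigcup_open => n _; have [] := CU n.
  + rewrite DE => x [k _ Ckx]; exists k => //.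
    by have [_ _ + _ _] := CU k; apply.
  + by move=> x [k _ Akx]; exists k => //; have [_ _ _ + _] := CU k; apply.
  have UDN : (\bigcup_n U n : set B) `\` D N `<=`
      \bigcup_n ((U n : set B) `\` C n) `|` (V `\` D N).
    move=> x [[n _ Unx] nD]; have [[k _ Ckx]|nV] := pselect (V x).
      by right; split => //; exists k.
    by left; exists n => //; split => // Cnx; apply: nV; exists n.
  have mUC n : measurable ((U n : set B) `\` C n) by exact: measurableD.
  apply: (@le_trans _ _
    (mu (\bigcup_n ((U n : set B) `\` C n) `|` (V `\` D N)))).
    apply: le_measure => //; rewrite inE.
      by apply: measurableD => //; exact: bigcupT_measurable.
    by apply: measurableU; [exact: bigcupT_measurable|exact: measurableD].
  apply: (le_trans (measureU2 _ _ _)).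
  + exact: bigcupT_measurable.
  + exact: measurableD.
  rewrite (splitr e) EFinD; apply: leeD.
  + apply: (@le_trans _ _ (\sum_(n <oo) mu ((U n : set B) `\` C n))%E).
      apply: measure_sigma_subadditive => //; exact: bigcupT_measurable.
    apply: le_trans (epsilon_trick0 xpredT (ltW e2)).
    by apply: lee_nneseries => // n _; have [] := CU n.
  + rewrite measureD// ?setIidr; last 2 first.
    * by rewrite -bigDE; exact: bigcup_sup.
    * by rewrite -ge0_fin_numE// fin_num_measure.
    by rewrite leeBlDr ?fin_num_measure// addeC -leeBlDr ?ltW.
- move=> U oU e e0.
  have [F [cF ndF FU]] := open_bigcup_closed G_metrizable oU.
  have mF n : measurable (F n : set B) by exact: closed_borel_measurable.
  have mU : measurable (U : set B) by exact: open_borel_measurable.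
  have [n mun] : exists n, (mu (U : set B) - e%:E < mu (F n : set B))%E.
    apply: lt_mu_bigcup => //.
    by rewrite FU lteBlDr// ?fin_num_measure// lteDl ?fin_num_measure.
  have FnU : F n `<=` U by rewrite -FU; exact: bigcup_sup.
  exists (F n), U; split => //.
  rewrite measureD// ?setIidr//; last first.
    by rewrite -ge0_fin_numE// fin_num_measure.
  by rewrite leeBlDr ?fin_num_measure// addeC -leeBlDr ?ltW.
Qed.

Lemma probability_outer_regular (mu : probability B R) (A : set B) :
  measurable A ->
  mu A = ereal_inf [set mu U | U in [set U : set G | open U /\ A `<=` U]].
Proof.
move=> mA; apply/eqP; rewrite eq_le; apply/andP; split.
  apply: le_ereal_inf_tmp => _ [U [oU AU] <-].
  by apply: le_measure; rewrite ?inE//; exact: open_borel_measurable.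
apply/lee_addgt0Pr => e e0.
have [C [U [cC oU CA AU muUC]]] := probability_regular mu mA e0.
have mU : measurable (U : set B) by exact: open_borel_measurable.
have mC : measurable (C : set B) by exact: closed_borel_measurable.
apply: (@le_trans _ _ (mu U)); first by apply: ereal_inf_lbound; exists U.
apply: (@le_trans _ _ (mu (A `|` (U : set B) `\` C))).
  apply: le_measure; rewrite ?inE//.
    by apply: measurableU => //; exact: measurableD.
  move=> x Ux; have [Cx|nCx] := pselect (C x); first by left; exact: CA.
  by right.
apply: (le_trans (measureU2 _ _ _)) => //; first exact: measurableD.
by rewrite leeD2l.
Qed.

Lemma compact_borel_measurable (K : set G) :
  compact K -> measurable (K : set B).
Proof.
move=> cK; apply: closed_borel_measurable.
exact: compact_closed (metrizable_hausdorff G_metrizable) cK.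
Qed.

(** An open set is an increasing union of closed sets, which are compact. *)
Lemma probability_inner_regular (mu : probability B R) (U : set G) :
  open U ->
  mu U = ereal_sup [set mu K | K in [set K : set G | compact K /\ K `<=` U]].
Proof.
move=> oU; apply/eqP; rewrite eq_le; apply/andP; split; last first.
  apply: ge_ereal_sup => _ [K [cK KU] <-]; apply: le_measure; rewrite ?inE//.
  - exact: compact_borel_measurable.
  - exact: open_borel_measurable.
have [F [cF ndF FU]] := open_bigcup_closed G_metrizable oU.
rewrite leNgt; apply/negP; rewrite -{2}FU => /lt_mu_bigcup[|//|n].
  by move=> n; exact: closed_borel_measurable.
apply/negP; rewrite -leNgt; apply: ereal_sup_ubound; exists (F n) => //.
split; first exact: subclosed_compact (cF n) G_compact _.
by rewrite -FU; exact: bigcup_sup.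
Qed.

End borel_probability.
Theorem corollary10 (R : realType) (G : topologicalZmodType)
    (G_compact : compact [set: G]) (G_metrizable : metrizable R G)
    (d : measure_display) (Omega : measurableType d) (P : probability Omega R)
    (X Y : {RV P >-> borel G})
    (XY_independent : independent_RVs X Y)
    (X_sim_XY : same_distribution P (X : Omega -> borel G)
       (fun w => (X w : G) + (Y w : G) : borel G))
    (Y_charges_open : forall U : set G, open U -> U !=set0 ->
       (0 < P (Y @^-1` U))%E) :
  is_normalized_haar_measure (distribution P X).
Proof.
set mu := distribution P X; set nu := distribution P Y.
have mu_fix (U : set G) : open U ->
    mu U = (\int[nu]_y mu (translation y @^-1` U))%E.
  move=> oU; rewrite -independent_sum_law//.
  exact: X_sim_XY (open_borel_measurable oU).
have mu_translate (g : G) (A : set (borel G)) : measurable A ->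
    mu (translation g @^-1` A) = mu A.
  pose mu_g := distribution mu (translation g).
  apply: (@eq_open_eq_measure R G mu_g mu) => U oU.
  exact: (fixed_by_convolution_open G_compact G_metrizable mu_fix).
split; last exact: probability_setT.
split.
- by rewrite [X in X != _]probability_setT oner_neq0.
- move=> K cK; apply: (@le_lt_trans _ _ 1%E); last exact: ltry.
  exact: (@probability_le1 _ _ _ mu K
    (compact_borel_measurable G_metrizable cK)).
- move=> A; exact: probability_outer_regular.
- move=> U; exact: probability_inner_regular.
(* The image of A by x |-> g + x is the preimage of A by translation by - g. *)
- move=> g A mA; apply: etrans (mu_translate (- g) A mA); congr (mu _).
  apply/seteqP; split => [_ [x Ax <-]|x Ax].
    by rewrite /translation /= addrC addKr.
  by exists ((x : G) - g) => //; rewrite addrC subrK.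
Qed.
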